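(* Let $p\ge 2$ and $P=\{312,\;2431,\;(p+1)p\cdots 21\}$. Then $P$ is colored regular with set of colors $\{0,1\}$: there is a coloring of $S(P)$ by colors in $\{0,1\}$, with the empty permutation colored $0$, such that for every $\alpha\in S(P)$ site $1$ is active, and if $\alpha$ has $k$ active sites and color $c$, then for every $1\le i\le k$ the permutation $\alpha^{\downarrow i}$ has $\mu_P(i,k,c)$ active sites and color $\nu_P(i,k,c)$, where $$\mu_P(i,k,c)=\begin{cases} i+1 & \text{if } i=1 \text{ or } (i=k,\ c=0 \text{ and } k<p),\\ i & \text{otherwise,}\end{cases}\qquad \nu_P(i,k,c)=\begin{cases} 0 & \text{if } i=1 \text{ or } (i=k \text{ and } c=0),\\ 1 & \text{otherwise.}\end{cases}$$
   Context: A permutation contains a pattern $\sigma$ if some subsequence is order-isomorphic to $\sigma$; $S_n(P)$ is the set of permutations of $\{1,\dots,n\}$ avoiding all patterns of $P$ ($S_0(P)=\{\epsilon\}$), $S(P)=\bigcup_n S_n(P)$. A site of a length-$n$ permutation is one of its $n+1$ gaps, numbered from right to left (site $1$ is after the last entry; $\epsilon$ has one site). $\alpha^{\downarrow i}$ denotes the permutation obtained from $\alpha\in S_n$ by inserting $n+1$ into site $i$. For $\alpha\in S_n(P)$, site $i$ is active if $\alpha^{\downarrow i}\in S_{n+1}(P)$. $P$ is right-justified if moving the largest entry of any $\alpha\in S(P)$ one position right (when possible) stays in $S(P)$ (the set $P$ here is right-justified). A right-justified $P$ is colored regular if there is an integer coloring of $S(P)$ with $\epsilon$ colored $0$ such that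 every $\alpha\in S(P)$ has site $1$ active and, if $\alpha$ has $k$ active sites and color $c$, then for $1\le i\le k$ both the number of active sites and the color of $\alpha^{\downarrow i}$ depend only on $(i,k,c)$. *)

(* Defs.v *)
From mathcomp Require Import all_boot all_order all_algebra.

Set Implicit Arguments.
Unset Strict Implicit.
Unset Printing Implicit Defensive.

(* Permutations of {1, ..., n} are words in one-line notation, of type seq nat;
   the empty permutation is [::]. *)
Definition is_permutation (s : seq nat) : bool := perm_eq s (iota 1 (size s)).

Definition order_isomorphic (s t : seq nat) : bool :=
  (size s == size t) &&
  [forall i : 'I_(size s), forall j : 'I_(size s),
     (nth 0 s i < nth 0 s j) == (nth 0 t i < nth 0 t j)].

(* The subsequences of s are the mask m s, for m a bit mask of size (size s). *)
Definition contains (s sigma : seq nat) : bool :=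
  [exists m : (size s).-tuple bool, order_isomorphic (mask m s) sigma].

(* S(P); the length-n slice S_n(P) is {s | avoiders P s and size s = n}. *)
Definition avoiders (P : seq (seq nat)) : pred (seq nat) :=
  fun s => is_permutation s && all (fun sigma => ~~ contains s sigma) P.

(* Sites are numbered from 1, from right to left: in a word of length n,
   site i (1 <= i <= n.+1) is preceded by n - i.-1 entries. *)
Definition insert_max (s : seq nat) (i : nat) : seq nat :=
  let l := size s - i.-1 in take l s ++ (size s).+1 :: drop l s.

Definition active (P : seq (seq nat)) (s : seq nat) (i : nat) : bool :=
  (1 <= i <= (size s).+1) && avoiders P (insert_max s i).

Definition nb_active (P : seq (seq nat)) (s : seq nat) : nat :=
  count (active P s) (iota 1 (size s).+1).

Definition right_justified (P : seq (seq nat)) : Prop :=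
  forall (s u v : seq nat) (x : nat),
    avoiders P s -> s = u ++ size s :: x :: v ->
    avoiders P (u ++ x :: size s :: v).

(* A coloring of S(P) is a total function on words whose values outside S(P)
   are irrelevant: for a right-justified P the active sites of s are exactly
   1, ..., nb_active P s, so every insert_max s i below is in S(P). *)
Definition coloring_follows (P : seq (seq nat)) (chi : seq nat -> int)
    (mu : nat -> nat -> int -> nat) (nu : nat -> nat -> int -> int) : Prop :=
  chi [::] = 0%R /\
  forall s, avoiders P s ->
    active P s 1 /\
    forall i, 1 <= i <= nb_active P s ->
      nb_active P (insert_max s i) = mu i (nb_active P s) (chi s) /\
      chi (insert_max s i) = nu i (nb_active P s) (chi s).

Definition colored_regular (P : seq (seq nat)) : Prop :=
  right_justified P /\ exists chi mu nu, coloring_follows P chi mu nu.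

Definition patterns (p : nat) : seq (seq nat) :=
  [:: [:: 3; 1; 2]; [:: 2; 4; 3; 1]; rev (iota 1 p.+1)].

Definition mu_P (p i k : nat) (c : int) : nat :=
  if (i == 1) || [&& i == k, c == 0%R & k < p] then i.+1 else i.

Definition nu_P (i k : nat) (c : int) : int :=
  if (i == 1) || ((i == k) && (c == 0%R)) then 0%R else 1%R.

(* Main.v *)
(* The idea: if [u ++ v] is in S(P), inserting a new maximum between [u] and [v]
   stays in S(P) if and only if [v] has fewer than [p] entries and reads
   m, m - 1, m - 2, ... (avoiding 312 makes [v] decreasing, and avoiding 2431
   forbids gaps, since the missing value would lie in [u]).  Hence the active
   sites are 1, ..., k, where k - 1 is the length of the longest such suffix,
   cut off at p - 1.  A new maximum inserted at a site i >= 2 extends the run to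
   its right exactly when that run starts with the old maximum, which forces
   i = k.  Color 0 means that the suffix of length k - 1 starts
   with the maximum, or that k = p, where the cut-off prevents growth. *)
Require Import Defs.
From mathcomp Require Import all_boot all_order all_algebra.
From mathcomp Require Import zify.

(** * Containment of the three patterns, in terms of subsequences *)

Lemma order_isomorphicP (s t : seq nat) :
  reflect (size s = size t /\ forall i j, i < size s -> j < size s ->
             (nth 0 s i < nth 0 s j) = (nth 0 t i < nth 0 t j))
          (order_isomorphic s t).
Proof.
apply: (iffP andP) => [[/eqP sz /forallP h]|[-> h]]; split => //.
  move=> i j lti ltj.
  by move: (h (Ordinal lti)) => /forallP/(_ (Ordinal ltj))/eqP.
by apply/forallP => i; apply/forallP => j; apply/eqP/h.
Qed.

Lemma containsP (s sigma : seq nat) :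
  reflect (exists2 t, subseq t s & order_isomorphic t sigma)
          (contains s sigma).
Proof.
apply: (iffP existsP) => [[m h]|[t /subseqP[m sz ->] h]].
  by exists (mask m s) => //; apply: mask_subseq.
by exists (tcast sz (in_tuple m)); rewrite val_tcast.
Qed.

Lemma order_isomorphic312 (t : seq nat) :
  reflect (exists a b c, t = [:: a; b; c] /\ b < c < a)
          (order_isomorphic t [:: 3; 1; 2]).
Proof.
apply: (iffP (order_isomorphicP _ _)) => [[]|[a [b [c [-> h]]]]].
  case: t => [|a [|b [|c []]]] //= _ h; exists a, b, c; split => //.
  by rewrite (h 1 2) // (h 2 0).
by split => // -[|[|[|i]]] [|[|[|j]]] //= _ _; lia.
Qed.

Lemma order_isomorphic2431 (t : seq nat) :
  reflect (exists a b c d, t = [:: a; b; c; d] /\ [/\ d < a, a < c & c < b])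
          (order_isomorphic t [:: 2; 4; 3; 1]).
Proof.
apply: (iffP (order_isomorphicP _ _)) => [[]|[a [b [c [d [-> [h1 h2 h3]]]]]]].
  case: t => [|a [|b [|c [|d []]]]] //= _ h; exists a, b, c, d; split => //.
  by rewrite (h 3 0) // (h 0 2) // (h 2 1).
by split => // -[|[|[|[|i]]]] [|[|[|[|j]]]] //= _ _; lia.
Qed.

Lemma order_isomorphic_rev_iota (q : nat) (t : seq nat) :
  reflect (size t = q /\ sorted gtn t) (order_isomorphic t (rev (iota 1 q))).
Proof.
have nthE i : i < q -> nth 0 (rev (iota 1 q)) i = q - i.
  by move=> iq; rewrite nth_rev size_iota // nth_iota; lia.
apply: (iffP (order_isomorphicP _ _)); rewrite size_rev size_iota.
  move=> [sz h]; split=> //; apply/(sortedP 0) => i lti.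
  by rewrite /gtn /= h //; [rewrite !nthE|]; lia.
move=> [sz srt]; split=> // i j; rewrite sz => iq jq; rewrite !nthE //.
have mono a b : a < q -> b < q -> a < b -> nth 0 t b < nth 0 t a.
  move=> aq bq ab.
  have tr : transitive gtn by move=> x y z /=; lia.
  by apply: (sorted_ltn_nth tr 0 srt) => //; rewrite inE sz.
have := mono i j iq jq; have := mono j i jq iq; case: (ltngtP i j) => [||->]; lia.
Qed.

Lemma subseq_cat_split (T : eqType) (t u v : seq T) :
  subseq t (u ++ v) ->
  exists t1 t2, [/\ t = t1 ++ t2, subseq t1 u & subseq t2 v].
Proof.
case/subseqP=> m sz ->.
have szm : size (take (size u) m) = size u.
  by rewrite size_takel // sz size_cat leq_addr.
exists (mask (take (size u) m) u), (mask (drop (size u) m) v).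
by rewrite !mask_subseq -mask_cat ?cat_take_drop.
Qed.

(** When an insertion is tested for avoidance, the first alternative is excluded by the old word, so
    only occurrences through the new entry need study. *)
Lemma subseq_insert (T : eqType) (t u v : seq T) (x : T) :
  subseq t (u ++ x :: v) ->
  subseq t (u ++ v) \/
  exists t1 t2, [/\ t = t1 ++ x :: t2, subseq t1 u & subseq t2 v].
Proof.
case/subseq_cat_split=> t1 [[|y t2] [-> s1 s2]].
  by left; rewrite cat_subseq ?sub0seq.
move: s2 => /=; case: eqP => [-> s2|_ s2]; first by right; exists t1, t2.
by left; apply: cat_subseq.
Qed.

(** * Runs of consecutive decreasing values *)

Definition descending_run : pred (seq nat) := sorted (fun a b => a == b.+1).

Lemma descending_run_gtn (v : seq nat) : descending_run v -> sorted gtn v.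
Proof. by apply: sub_sorted => a b /eqP-> /=. Qed.

Lemma descending_run_drop (v : seq nat) (j : nat) :
  descending_run v -> descending_run (drop j v).
Proof. by rewrite -{1}(cat_take_drop j v); move/cat_sorted2=> []. Qed.

(** The values of a nonempty run fill the whole interval from its last entry to its first. This
    later rules out 2431 with the new maximum as its 4. *)
Lemma mem_descending_run (v : seq nat) (a b c : nat) :
  descending_run v -> b \in v -> c \in v -> c < a < b -> a \in v.
Proof.
case: v => // x v.
have last_le y w : descending_run (y :: w) -> last y w <= y.
  rewrite /descending_run; elim: w y => //= z w IH y /andP[/eqP-> /IH]; lia.
have memE y : descending_run (x :: v) -> (y \in x :: v) = (last x v <= y <= x).
  elim: v x => [|z v IH] x; first by rewrite inE /=; lia.
  move=> /= /andP[/eqP-> run_v]; have := last_le z v run_v.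
  by rewrite in_cons IH //=; lia.
by move=> run_v; rewrite !memE //; lia.
Qed.

(** * Permutations and avoidance *)

Lemma is_permutation_uniq (s : seq nat) : is_permutation s -> uniq s.
Proof. by move/perm_uniq->; apply: iota_uniq. Qed.

Lemma mem_is_permutation (s : seq nat) (x : nat) :
  is_permutation s -> (x \in s) = (0 < x <= size s).
Proof. by move/perm_mem->; rewrite mem_iota; lia. Qed.

Lemma is_permutation_insert (u v : seq nat) :
  is_permutation (u ++ (size (u ++ v)).+1 :: v) = is_permutation (u ++ v).
Proof.
rewrite /is_permutation.
have -> : size (u ++ (size (u ++ v)).+1 :: v) = (size (u ++ v)).+1.
  by rewrite !size_cat addnS.
set n := size _.
have -> : iota 1 n.+1 = rcons (iota 1 n) n.+1.
  by rewrite -[n.+1]addn1 iotaD cats1 addnC.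
rewrite -[in RHS](perm_cons n.+1) -cat1s perm_catCA /=.
by rewrite [in LHS]perm_sym perm_rcons perm_sym.
Qed.

Lemma avoidersP (p : nat) (s : seq nat) :
  reflect [/\ is_permutation s,
    forall a b c, subseq [:: a; b; c] s -> ~~ (b < c < a),
    forall a b c d, subseq [:: a; b; c; d] s -> ~ [/\ d < a, a < c & c < b]
    & forall t, subseq t s -> sorted gtn t -> size t != p.+1]
  (avoiders (patterns p) s).
Proof.
rewrite /avoiders /patterns; apply: (iffP andP).
  case=> perm_s /and4P[n1 n2 n3 _]; split=> //.
  - move=> a b c sub; apply: contra n1 => h; apply/containsP.
    by exists [:: a; b; c] => //; apply/order_isomorphic312; exists a, b, c.
  - move=> a b c d sub h; case/containsP: n2.
    exists [:: a; b; c; d] => //.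
    by apply/order_isomorphic2431; exists a, b, c, d.
  move=> t sub srt; apply: contra n3 => /eqP sz; apply/containsP.
  by exists t => //; apply/order_isomorphic_rev_iota.
case=> perm_s h1 h2 h3; split=> //; apply/and4P; split=> //; apply/containsP.
- case=> t sub /order_isomorphic312[a [b [c [tE]]]].
  by apply/negP/h1; rewrite -tE.
- case=> t sub /order_isomorphic2431[a [b [c [d [tE]]]]].
  by apply: h2; rewrite -tE.
by case=> t sub /order_isomorphic_rev_iota[/eqP sz srt]; apply/negP: sz; apply: h3.
Qed.

(** * Deleting and inserting the maximum *)

Lemma avoiders_delete_max (p : nat) (u v : seq nat) :
  avoiders (patterns p) (u ++ (size (u ++ v)).+1 :: v) ->
  avoiders (patterns p) (u ++ v).
Proof.
have sub : subseq (u ++ v) (u ++ (size (u ++ v)).+1 :: v).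
  by rewrite cat_subseq ?subseq_cons.
case/avoidersP=> perm_s h1 h2 h3; apply/avoidersP; split.
- by rewrite -is_permutation_insert.
- by move=> a b c h; apply: h1; apply: subseq_trans h sub.
- by move=> a b c d h; apply: h2; apply: subseq_trans h sub.
by move=> t h; apply: h3; apply: subseq_trans h sub.
Qed.

Lemma avoiders_insert_run (p : nat) (u v : seq nat) :
  avoiders (patterns p) (u ++ (size (u ++ v)).+1 :: v) ->
  (size v < p) && descending_run v.
Proof.
move=> av; have := avoiders_delete_max _ _ _ av.
case/avoidersP=> perm_s _ _ _; case/avoidersP: av => _.
set n := size _ in perm_s * => h1 h2 h3.
have le_n x : x \in u ++ v -> x <= n by rewrite mem_is_permutation // => /andP[].
(* An ascent in [v] would form 312 with the new maximum in front as its 3. *)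
have h312 a b : subseq [:: a; b] v -> b < a.
  move=> sub.
  have in_v x : x \in [:: a; b] -> x <= n.
    by move=> /(mem_subseq sub) xv; rewrite le_n // mem_cat xv orbT.
  have /h1 : subseq [:: n.+1; a; b] (u ++ n.+1 :: v).
    by apply: subseq_trans (suffix_subseq _ _); rewrite /= eqxx.
  have : a != b.
    have := is_permutation_uniq _ perm_s; rewrite cat_uniq => /and3P[_ _].
    by move/(subseq_uniq sub); rewrite /= inE andbT.
  have := in_v a; have := in_v b; rewrite !inE !eqxx orbT; lia.
have run_v : descending_run v.
  apply/(sortedP 0) => i lti; apply/eqP.
  set a := nth 0 v i; set b := nth 0 v i.+1.
  have vE : v = take i v ++ a :: b :: drop i.+2 v.
    by rewrite -!drop_nth ?cat_take_drop // ltnW.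
  have sub_ab : subseq [:: a; b] v.
    rewrite vE; apply: subseq_trans (suffix_subseq _ _).
    by rewrite /= !eqxx sub0seq.
  have ltba := h312 _ _ sub_ab.
  (* If [a] exceeds [b.+1], the value [b.+1] occurs somewhere. In [u] it gives the 2431 occurrence
     [b.+1], [n.+1], [a], [b]; in [v] it lies before [a] or after [b], and either way creates an
     ascent. *)
  case: (ltngtP a b.+1) => [|ltb1a|//]; first by lia.
  have le_an : a <= n.
    by rewrite le_n // mem_cat (mem_subseq sub_ab) ?inE ?eqxx ?orbT.
  have : b.+1 \in u ++ v by rewrite mem_is_permutation // -/n; lia.
  rewrite mem_cat => /orP[b1u|].
    suff /h2[] : subseq [:: b.+1; n.+1; a; b] (u ++ n.+1 :: v) by split; lia.
    apply: (@cat_subseq _ [:: b.+1] [:: n.+1; a; b]); first by rewrite sub1seq.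
    by rewrite /= eqxx.
  rewrite vE mem_cat !inE => /or4P[b1|||b1]; try by lia.
    suff /h312 : subseq [:: b.+1; a] v by lia.
    rewrite vE; apply: (@cat_subseq _ [:: b.+1] [:: a]); rewrite sub1seq //.
    by rewrite inE eqxx.
  suff /h312 : subseq [:: b; b.+1] v by lia.
  rewrite vE; apply: subseq_trans (suffix_subseq _ _).
  apply: subseq_trans (subseq_cons _ _).
  by rewrite /= eqxx sub1seq.
rewrite run_v andbT ltnNge; apply/negP => lepv.
(* If [v] had [p] entries or more, the new maximum and the first [p] of them would form the
   decreasing pattern of length [p.+1]. *)
have sub : subseq (n.+1 :: take p v) (u ++ n.+1 :: v).
  apply: subseq_trans (suffix_subseq _ _).
  by rewrite /= eqxx take_subseq.
suff /(h3 _ sub) : sorted gtn (n.+1 :: take p v).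
  by rewrite /= size_takel // eqxx.
have srt : sorted gtn v by apply: descending_run_gtn.
have : sorted gtn (take p v) by rewrite take_sorted.
case: v lepv {sub srt run_v h312 h1 h2 h3 perm_s} @n le_n => [|x v] lepv n le_n.
  by [].
case: p lepv => //= p _ ->; rewrite andbT ltnS le_n //.
by rewrite mem_cat inE eqxx orbT.
Qed.

Lemma run_avoiders_insert (p : nat) (u v : seq nat) :
  avoiders (patterns p) (u ++ v) -> size v < p -> descending_run v ->
  avoiders (patterns p) (u ++ (size (u ++ v)).+1 :: v).
Proof.
case/avoidersP=> perm_s h1 h2 h3 ltvp run_v.
have srt_v := descending_run_gtn _ run_v.
have tr : transitive gtn by move=> x y z /=; lia.
have := is_permutation_insert u v.
set n := size _ => perm_s'.
have le_n x : x \in u ++ v -> x <= n by rewrite mem_is_permutation // => /andP[].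
have le_u t x : subseq t u -> x \in t -> x <= n.
  by move=> /mem_subseq sub /sub xu; rewrite le_n // mem_cat xu.
have le_v t x : subseq t v -> x \in t -> x <= n.
  by move=> /mem_subseq sub /sub xv; rewrite le_n // mem_cat xv orbT.
apply/avoidersP; split; first by rewrite perm_s'.
- move=> a b c /subseq_insert[/h1//|[t1 [t2 [tE sub1 sub2]]]].
  (* [t1] is the part of the occurrence before the new maximum. As the 3, the maximum needs an
     ascent in the decreasing [v]; in any later place it would be smaller than an entry of [u]. *)
  case: t1 tE sub1 => [|x [|y [|z []]]] //=.
  + case=> aE tE _; rewrite -tE in sub2.
    by have /= := subseq_sorted tr sub2 srt_v; lia.
  + by case=> -> -> _ sub1; have := le_u _ x sub1; rewrite inE eqxx; lia.
  + by case=> -> -> -> _ sub1; have := le_u _ x sub1; rewrite inE eqxx; lia.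
- move=> a b c d /subseq_insert[/h2//|[t1 [t2 [tE sub1 sub2]]]] [lda lac lcb].
  case: t1 tE sub1 => [|x [|y [|z [|w []]]]] //=.
  + case=> aE tE _; rewrite -tE in sub2.
    by have := le_v _ c sub2; rewrite !inE eqxx orbT; lia.
  (* The new maximum is the 4. The 2 lies in [u], but its value is between the 3 and the 1, both in
     the run [v], so it would also occur in [v]. *)
  + case=> <- bE tE sub1; rewrite -tE in sub2.
    have av : a \in v.
      apply: (mem_descending_run v a c d run_v); last by lia.
        by rewrite (mem_subseq sub2) ?inE ?eqxx.
      by rewrite (mem_subseq sub2) ?inE ?eqxx ?orbT.
    have := is_permutation_uniq _ perm_s; rewrite cat_uniq => /and3P[_ /hasP[]].
    by exists a => //; apply: (mem_subseq sub1); rewrite inE.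
  + by case=> _ <- cE _ sub1; have := le_u _ b sub1; rewrite !inE eqxx orbT; lia.
  + by case=> _ <- _ dE _ sub1; have := le_u _ b sub1; rewrite !inE eqxx orbT; lia.
move=> t /subseq_insert[/h3//|[t1 [t2 [-> sub1 sub2]]]].
(* A decreasing subsequence through the new maximum must start with it, and [v] has fewer than [p]
   entries to continue it. *)
case: t1 sub1 => [|x t1] sub1.
  by move=> _; rewrite /= eqSS ltn_eqF // (leq_ltn_trans (size_subseq sub2)).
rewrite -cat_rcons => /cat_sorted2[]; rewrite /= => srt _.
have : n.+1 < x.
  have /allP := order_path_min tr srt.
  by apply; rewrite mem_rcons inE eqxx.
by have := le_u _ x sub1; rewrite inE eqxx; lia.
Qed.

Lemma avoiders_insert (p : nat) (u v : seq nat) :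
  avoiders (patterns p) (u ++ v) ->
  avoiders (patterns p) (u ++ (size (u ++ v)).+1 :: v) =
  (size v < p) && descending_run v.
Proof.
move=> av; apply/idP/andP => [/avoiders_insert_run/andP//|[]].
exact: run_avoiders_insert.
Qed.

(** Moving the maximum past [x] amounts to deleting it and reinserting it before a suffix with one
    entry less; a run remains a run when its first entry is dropped. *)
Lemma right_justified_patterns (p : nat) : right_justified (patterns p).
Proof.
move=> s u v x av sE.
have szE : size s = (size (u ++ x :: v)).+1.
  by rewrite sE !size_cat /= !addnS.
rewrite szE in sE *; rewrite sE in av.
have av0 := avoiders_delete_max _ _ _ av.
have /andP[/= ltvp run_v] := avoiders_insert_run _ _ _ av.
rewrite -cat_rcons in av0; have := run_avoiders_insert p _ v av0.
rewrite !cat_rcons; apply; first exact: ltnW.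
exact: path_sorted run_v.
Qed.

(** * Active sites and their number *)

Lemma activeE (p : nat) (s : seq nat) (i : nat) :
  avoiders (patterns p) s ->
  active (patterns p) s i =
  [&& 0 < i <= (size s).+1, i <= p & descending_run (drop (size s - i.-1) s)].
Proof.
move=> av; rewrite /active; case: (boolP (0 < i <= _)) => //= /andP[i0 leis].
rewrite /insert_max; set l := _ - _.
have := avoiders_insert p (take l s) (drop l s).
rewrite cat_take_drop size_drop => ->//.
by congr andb; lia.
Qed.

(** Suffixes of runs are runs, so the active sites form an initial segment. Bounds on their number
    thus reduce to testing a single site. *)
Lemma leq_nb_active (p : nat) (s : seq nat) (i : nat) :
  avoiders (patterns p) s -> 0 < i ->
  (i <= nb_active (patterns p) s) = active (patterns p) s i.
Proof.
move=> av i0; rewrite /nb_active; set A := active _ _.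
have closed j k : 0 < j -> j <= k -> A k -> A j.
  move=> j0 lejk; rewrite /A !activeE // => /and3P[leks lekp run_k].
  apply/and3P; split; [lia|lia|].
  have -> : size s - j.-1 = (k - j) + (size s - k.-1) by lia.
  by rewrite -drop_drop; apply: descending_run_drop.
have out j : (size s).+1 < j -> A j = false.
  by move=> h; rewrite /A /active; lia.
suff cnt n : forall j, 0 < j -> (j <= count A (iota 1 n)) = A j && (j <= n).
  rewrite cnt //; case: (leqP i (size s).+1) => [|/out->//].
  by rewrite andbT.
elim: n => [|n IH] j j0; first by rewrite /= andbC; lia.
rewrite -[n.+1]addn1 iotaD count_cat /= add1n addn0 addn1.
case An : (A n.+1); last first.
  rewrite addn0 IH // (leq_eqVlt j n.+1) ltnS andb_orr.
  by case: (j =P n.+1) => [->|]; rewrite ?An //= andbF.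
have -> : count A (iota 1 n) = n.
  rewrite -[RHS](size_iota 1 n); apply/eqP; rewrite -all_count.
  by apply/allP => k; rewrite mem_iota => h; apply: closed An; lia.
rewrite addn1; case: leqP => h; last by rewrite andbF.
by rewrite andbT (closed _ _ _ _ An).
Qed.

(** * Active sites and color after an insertion *)

(** Three sites are tested: the one just right of the new maximum, which stays active; the one just
    left of it, active when [n.+1 :: v] is a short enough run; and the next one, never active. The
    default [n] of [head] makes an empty [v] count as starting with the old maximum, since a single
    entry is a run. *)
Lemma nb_active_insert (p : nat) (u v : seq nat) (n := size (u ++ v)) :
  avoiders (patterns p) (u ++ v) -> avoiders (patterns p) (u ++ n.+1 :: v) ->
  nb_active (patterns p) (u ++ n.+1 :: v) =
  (size v).+1 + (((size v).+1 < p) && (head n v == n)).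
Proof.
move=> av av'; have := avoiders_insert _ _ _ av; rewrite -/n av'.
case/esym/andP=> ltvp run_v.
have perm_s : is_permutation (u ++ v) by case/avoidersP: av.
have szE : size (u ++ n.+1 :: v) = n.+1 by rewrite /n !size_cat addnS.
have nE : n = size u + size v by rewrite /n size_cat.
have leq_nb j : 0 < j -> _ := fun h => leq_nb_active p _ j av' h.
have dropE j : size u <= j ->
    drop j (u ++ n.+1 :: v) = drop (j - size u) (n.+1 :: v).
  by move=> h; rewrite drop_cat ltnNge h.
have h1 : (size v).+1 <= nb_active (patterns p) (u ++ n.+1 :: v).
  rewrite leq_nb // activeE // szE dropE; last by lia.
  have -> : n.+1 - (size v).+1.-1 - size u = 1 by lia.
  by rewrite /= drop0 run_v; lia.
have h2 : ((size v).+2 <= nb_active (patterns p) (u ++ n.+1 :: v)) =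
          ((size v).+1 < p) && (head n v == n).
  rewrite leq_nb // activeE // szE dropE; last by lia.
  have -> : n.+1 - (size v).+2.-1 - size u = 0 by lia.
  have -> : descending_run (drop 0 (n.+1 :: v)) = (head n v == n).
    case: (v) run_v => [|x w] /= run_v; first by rewrite eqxx.
    by rewrite /descending_run /= [path _ _ _]run_v andbT eqSS eq_sym.
  by case: (_ == _); rewrite ?andbF ?andbT //; lia.
have h3 : nb_active (patterns p) (u ++ n.+1 :: v) < (size v).+3.
  rewrite ltnNge leq_nb // activeE // szE; apply/negP => /and3P[le3 _].
  case/lastP: u @n av av' perm_s szE nE leq_nb dropE h1 h2 le3 =>
    [|u x] n av av' perm_s szE nE leq_nb dropE h1 h2 le3; first by simpl in nE; lia.
  rewrite cat_rcons drop_cat.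
  rewrite size_rcons in nE.
  have -> : n.+1 - (size v).+3.-1 = size u by lia.
  (* A run through this site would have [n.+2] just before [n.+1], but the old entries are at most
     [n]. *)
  rewrite ltnn subnn drop0 /descending_run /= => /andP[/eqP xE _].
  suff : x <= n by lia.
  have : x \in rcons u x ++ v by rewrite mem_cat mem_rcons inE eqxx.
  by rewrite mem_is_permutation // => /andP[].
by rewrite -h2; lia.
Qed.

(* On the empty word [nth] returns its default 0, which is the size of that
   word, whence color 0. *)
Definition suffix_color (p : nat) (s : seq nat) : int :=
  let k := nb_active (patterns p) s in
  if (k == p) || (nth 0 s (size s - k.-1) == size s) then 0%R else 1%R.

Lemma suffix_color_eq0 (p : nat) (s : seq nat) (k := nb_active (patterns p) s) :
  (suffix_color p s == 0%R) =
  (k == p) || (nth 0 s (size s - k.-1) == size s).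
Proof. by rewrite /suffix_color -/k; case: ifP. Qed.

(** If the run grew, the suffix defining the color starts with the new maximum [n.+1]. If it did not
    grow and the cut-off is not reached, that suffix is [v], nonempty and with entries at most
    [n]. *)
Lemma suffix_color_insert (p : nat) (u v : seq nat) (n := size (u ++ v))
    (s' := u ++ n.+1 :: v) :
  2 <= p -> avoiders (patterns p) (u ++ v) -> avoiders (patterns p) s' ->
  (suffix_color p s' == 0%R) = ((size v).+1 == p) || (head n v == n).
Proof.
move=> hp av av'; have := avoiders_insert _ _ _ av; rewrite -/n -/s' av'.
case/esym/andP=> ltvp run_v.
have perm_s : is_permutation (u ++ v) by case/avoidersP: av.
have szE : size s' = n.+1 by rewrite /s' /n !size_cat addnS.
have nE : n = size u + size v by rewrite /n size_cat.
rewrite suffix_color_eq0 nb_active_insert // -/n -/s' szE.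
case: (ltngtP (size v).+1 p) => [ltp| |->]; [|lia|by rewrite addn0 eqxx].
rewrite /=; case: (altP (head n v =P n)) => hv.
  have -> : n.+1 - ((size v).+1 + true).-1 = size u by lia.
  by rewrite /s' nth_cat ltnn subnn /= eqxx orbT.
rewrite addn0 /= (ltn_eqF ltp) /=.
have v0 : 0 < size v by case: (v) hv; rewrite //= eqxx.
have -> : n.+1 - (size v + 0) = (size u).+1 by lia.
rewrite /s' nth_cat ltnNge leqnSn /= subSnn /=.
have : nth 0 v 0 \in u ++ v by rewrite mem_cat mem_nth ?orbT.
by rewrite mem_is_permutation // -/n; lia.
Qed.

(** At site 1 the suffix is empty and [head] returns its default [size s]. For [1 < i < k], site
    [i.+1] is active too, so the suffix of length [i.-1] extends to a run one entry to the left;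
    starting with the maximum would force a larger entry there. *)
Lemma head_suffix_max (p : nat) (s : seq nat) (i : nat)
    (k := nb_active (patterns p) s) :
  avoiders (patterns p) s -> 0 < i <= k ->
  (head (size s) (drop (size s - i.-1) s) == size s) =
  (i == 1) || ((i == k) && (nth 0 s (size s - k.-1) == size s)).
Proof.
move=> av /andP[i0 leik].
have perm_s : is_permutation s by case/avoidersP: av.
have leis : i <= (size s).+1.
  by move: leik; rewrite leq_nb_active // => /andP[/andP[]].
case: (altP (i =P 1)) => [->|i1] /=.
  by rewrite subn0 drop_size /= eqxx.
have lts : size s - i.-1 < size s by lia.
rewrite (drop_nth 0) //=.
case: (altP (i =P k)) => [->//|ik] /=; apply/negbTE/eqP => maxE.
have : i.+1 <= k by lia.
rewrite leq_nb_active // activeE // => /and3P[/andP[_ les] _].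
have lts' : size s - i.+1.-1 < size s by lia.
rewrite (drop_nth 0) //.
have -> : (size s - i.+1.-1).+1 = size s - i.-1 by lia.
rewrite (drop_nth 0) // maxE /descending_run /= => /andP[/eqP bad _].
have := mem_nth 0 lts'; rewrite bad mem_is_permutation //; lia.
Qed.

Lemma suffix_coloring_follows (p : nat) :
  2 <= p -> coloring_follows (patterns p) (suffix_color p) (mu_P p) nu_P.
Proof.
move=> hp; split.
  by apply/eqP; rewrite suffix_color_eq0 /= orbT.
move=> s av; split.
  by rewrite activeE // subn0 drop_size /=; lia.
move=> i leik; have /andP[i0 leik'] := leik.
have act := leik'; rewrite leq_nb_active // in act.
have av' : avoiders (patterns p) (insert_max s i) by case/andP: act.
have := act; rewrite activeE // => /and3P[/andP[_ leis] leip _].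
set k := nb_active _ s in leik leik' *.
have lekp : k <= p.
  have : k <= k by [].
  by rewrite leq_nb_active ?(leq_trans i0) // activeE // => /and3P[].
have headE := head_suffix_max p s i av leik.
have c0 := suffix_color_eq0 p s.
move: av' headE c0; rewrite /insert_max.
have := cat_take_drop (size s - i.-1) s.
have : (size (drop (size s - i.-1) s)).+1 = i by rewrite size_drop; lia.
(* From here [u] and [v] are any words with [u ++ v] equal to [s] and site [i] between them, so the
   insertion lemmas apply with [i] equal to [(size v).+1]. *)
rewrite -/k; move: (take _ s) (drop _ s) => u v szv sE av' headE c0.
rewrite -[in RHS]sE.
have := nb_active_insert p u v; have := suffix_color_insert p u v hp.
rewrite sE szv headE => /(_ av av') chiE /(_ av av') ->; rewrite headE.
have colE t : suffix_color p t = if suffix_color p t == 0%R then 0%R else 1%R.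
  by rewrite suffix_color_eq0.
rewrite [suffix_color p (u ++ _)]colE chiE /mu_P /nu_P c0.
(* [b] records whether the suffix of length [k.-1] starts with the maximum; the color is 0 when [b]
   holds or [k] equals [p]. *)
move: (nth _ _ _ == _) {headE c0 chiE} => b.
have ltpk : (k < p) = (k != p) by rewrite ltn_neqAle lekp andbT.
(* Site 1 yields two active sites because [1 < p]. *)
case: (altP (i =P 1)) => [->|i1] /=; first by rewrite hp orbT.
(* At [i = k], growth needs [b] and [k < p]. Under [k < p] the truth of [b] is the same as color 0,
   in agreement with [mu_P]. *)
case: (altP (i =P k)) => [->|ik] /=.
  by rewrite ltpk; case: (k == p); case: b; rewrite ?addn0 ?addn1.
(* Here [i < k <= p], so the cut-off is not reached and the color is 1. *)
have -> : (i == p) = false by apply/negbTE; lia.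
by rewrite andbF addn0.
Qed.

Theorem theorem3 (p : nat) (hp : 2 <= p) :
  colored_regular (patterns p) /\
  exists chi : seq nat -> int,
    (forall s : seq nat, avoiders (patterns p) s ->
       chi s = 0%R \/ chi s = 1%R) /\
    coloring_follows (patterns p) chi (mu_P p) nu_P.
Proof.
have follows := suffix_coloring_follows p hp.
split.
  split; first exact: right_justified_patterns.
  by exists (suffix_color p), (mu_P p), nu_P.
exists (suffix_color p); split=> // s _.
by rewrite /suffix_color; case: ifP; [left|right].
Qed.
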